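(* Let $\gamma: I\to\mathbb{E}_1^3$ be a unit speed spacelike curve on a spacelike surface $M\subset\mathbb{E}_1^3$, with geodesic curvature $\kappa_g$, normal curvature $\kappa_n$ and geodesic torsion $\tau_g$. Then $\gamma$ is a relatively normal-slant helix if and only if any one of the following three functions is a constant function: (i) $\tanh\alpha=\mu(s)=\pm\left[\dfrac{\kappa_g^2}{(\kappa_g^2-\tau_g^2)^{3/2}}\left(\dfrac{\tau_g}{\kappa_g}\right)'-\dfrac{\kappa_n}{(\kappa_g^2-\tau_g^2)^{1/2}}\right]$, (ii) $\coth\beta=\eta(s)=\pm\left[\dfrac{\kappa_g^2}{(\kappa_g^2-\tau_g^2)^{3/2}}\left(\dfrac{\tau_g}{\kappa_g}\right)'-\dfrac{\kappa_n}{(\kappa_g^2-\tau_g^2)^{1/2}}\right]$, (iii) $\cot\theta=\psi(s)=\mp\left[\dfrac{\kappa_g^2}{(\tau_g^2-\kappa_g^2)^{3/2}}\left(\dfrac{\tau_g}{\kappa_g}\right)'-\dfrac{\kappa_n}{(\tau_g^2-\kappa_g^2)^{1/2}}\right]$.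
   Context: $\mathbb{E}_1^3$ is $\mathbb{R}^3$ with $\langle x,y\rangle=-x_1y_1+x_2y_2+x_3y_3$. A vector $x$ is spacelike if $\langle x,x\rangle>0$ or $x=0$, timelike if $\langle x,x\rangle<0$, lightlike if $\langle x,x\rangle=0$ (and $x\neq0$). A curve is spacelike (timelike) if its velocity is; a surface is spacelike (timelike) if its unit normal is timelike (spacelike). Everything is smooth, $I$ is an interval, $s$ is arc length and $'=d/ds$. Darboux frame: for $\gamma$ a unit speed spacelike curve on a spacelike surface $M$ with unit normal $N$ along $\gamma$, put $T=\gamma'$, $B=N\times T$ (Lorentzian cross product $x\times y=(x_2y_3-x_3y_2,\,x_1y_3-x_3y_1,\,x_2y_1-x_1y_2)$). Then $\langle T,T\rangle=\langle B,B\rangle=1$, $\langle N,N\rangle=-1$, the three are mutually orthogonal, and $\kappa_g,\kappa_n,\tau_g$ are defined by $$T'=\kappa_gB+\kappa_nN,\quad B'=-\kappa_gT+\tau_gN,\quad N'=\kappa_nT+\tau_gB.$$ The principal normal $n$ of $\gamma$ (with $T'=\kappa n$, $\kappa$ the curvature) is spacelike: $\langle n,n\rangle=1$. Relatively normal-slant helix: $B$ makes a constant angle with a fixed direction, i.e. there is a constant unit vector $d$ ($\langle d,d\rangle=\pm1$), called the axis, with $\langle B,d\rangle$ constant along $\gamma$. In (i), (ii), (iii) the sign $\pm$ or $\mp$ is a fixed choice, and $\alpha,\beta,\theta$ denote the constant angles between $B$ and $d$: $\langle B,d\rangle=\sinh\alpha$ for $d$ timelike in (i); $\langle B,d\rangle=\cosh\beta$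 for $d$ spacelike in (ii); $\langle B,d\rangle=\cos\theta$ for $d$ spacelike in (iii). The formulas are understood where they are defined: $\kappa_g\neq0$, with $\kappa_g^2>\tau_g^2$ in (i) and (ii) and $\tau_g^2>\kappa_g^2$ in (iii).
   Formalization: In (iii) the sign of the κ_n term is corrected: the bracket is proved with +κ_n/(τ_g²−κ_g²)^{1/2}, since the printed minus sign makes the claim false; κ_g≠0 and κ_g²≠τ_g² are assumed along the whole curve, so that the formulas are defined. *)

(* Defs.v *)
From HB Require Import structures.
From mathcomp Require Import all_boot all_order all_algebra.
From mathcomp Require Import all_classical all_reals all_analysis.

Set Implicit Arguments.
Unset Strict Implicit.
Unset Printing Implicit Defensive.

Import Order.TTheory GRing.Theory Num.Theory.
Import numFieldNormedType.Exports.

Local Open Scope classical_set_scope.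
Local Open Scope ring_scope.

Section Hyperbolic.
Variable R : realType.
Implicit Type x : R.

Definition sinh x : R := (expR x - expR (- x)) / 2.
Definition cosh x : R := (expR x + expR (- x)) / 2.
Definition tanh x : R := sinh x / cosh x.
(* coth and cot are only meaningful for x != 0 and sin x != 0 respectively. *)
Definition coth x : R := cosh x / sinh x.
Definition cot x : R := cos x / sin x.

End Hyperbolic.

Section Smoothness.
Variables (R : realType) (V W : normedModType R).

(* All iterated directional derivatives up to order k exist and are continuous
   on U; meant for U open. *)
Fixpoint Ck_on (U : set V) (k : nat) (f : V -> W) : Prop :=
  match k with
  | 0 => forall x, U x -> {for x, continuous f}
  | k'.+1 => (forall x, U x -> differentiable f x) /\
             (forall v, Ck_on U k' (fun x => 'D_v f x))
  end.

(* As usual, a map is smooth on an arbitrary set A (for instance an interval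
   with end points) if it is smooth on an open neighbourhood of A.  At an end
   point of a nondegenerate interval, the derivatives only depend on the
   restriction to the interval, since they are continuous. *)
Definition smooth_on (A : set V) (f : V -> W) : Prop :=
  exists U : set V, [/\ open U, A `<=` U & forall k, Ck_on U k f].

End Smoothness.

Section Minkowski.
Variable R : realType.
Notation E13 := 'rV[R]_3.

Definition lorentz (x y : E13) : R :=
  - (x 0 0 * y 0 0) + x 0 1 * y 0 1 + x 0 2 * y 0 2.

Definition lcross (x y : E13) : E13 :=
  \row_(i < 3) [:: x 0 1 * y 0 2 - x 0 2 * y 0 1;
                   x 0 0 * y 0 2 - x 0 2 * y 0 0;
                   x 0 1 * y 0 0 - x 0 0 * y 0 1]`_i.

Definition spacelike (x : E13) : Prop := 0 < lorentz x x \/ x = 0.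
Definition timelike (x : E13) : Prop := lorentz x x < 0.

Definition local_param (M : set E13) (U : set 'rV[R]_2) (O : set E13)
    (X : 'rV[R]_2 -> E13) : Prop :=
  [/\ open U /\ open O,
      smooth_on U X /\ X @` U = O `&` M,
      exists Y : E13 -> 'rV[R]_2,
        {within O `&` M, continuous Y} /\ (forall q, U q -> Y (X q) = q)
    & forall q h, U q -> 'D_h X q = 0 -> h = 0].

Definition regular_surface (M : set E13) : Prop :=
  forall p, M p -> exists U O X, O p /\ local_param M U O X.

Definition tangent_to (M : set E13) (p w : E13) : Prop :=
  exists (c : R -> E13) (e : R),
    [/\ 0 < e, smooth_on `](- e), e[%classic c,
        forall t, - e < t < e -> M (c t), c 0 = p & derive1 c 0 = w].

Definition unit_normal (M : set E13) (p nu : E13) : Prop :=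
  (forall w, tangent_to M p w -> lorentz nu w = 0) /\ `|lorentz nu nu| = 1.

Definition spacelike_surface (M : set E13) : Prop :=
  regular_surface M /\
  forall p, M p -> exists nu, unit_normal M p nu /\ timelike nu.

Definition nondegenerate_interval (I : set R) : Prop :=
  is_interval I /\ exists a b, [/\ I a, I b & a < b].

Section Curve.
Variables (I : set R) (gamma N : R -> E13).

Definition unit_speed_spacelike : Prop :=
  smooth_on I gamma /\
  forall s, I s ->
    spacelike (derive1 gamma s) /\ lorentz (derive1 gamma s) (derive1 gamma s) = 1.

Definition unit_normal_along (M : set E13) : Prop :=
  smooth_on I N /\
  forall s, I s -> unit_normal M (gamma s) (N s) /\ timelike (N s).

Definition spacelike_principal_normal : Prop :=
  forall s, I s -> exists (k : R) (n : E13),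
    [/\ 0 < k, derive1 (derive1 gamma) s = k *: n & lorentz n n = 1].

Definition tangent : R -> E13 := derive1 gamma.
Definition binormal : R -> E13 := fun s => lcross (N s) (tangent s).

Definition darboux_curvatures (kg kn tg : R -> R) : Prop :=
  [/\ smooth_on I kg, smooth_on I kn, smooth_on I tg
    & forall s, I s ->
      [/\ derive1 tangent s = kg s *: binormal s + kn s *: N s,
          derive1 binormal s = - kg s *: tangent s + tg s *: N s
        & derive1 N s = kn s *: tangent s + tg s *: binormal s]].

Definition relatively_normal_slant_helix : Prop :=
  exists (d : E13) (c : R),
    (lorentz d d = 1 \/ lorentz d d = -1) /\
    forall s, I s -> lorentz (binormal s) d = c.

End Curve.

(* The boolean b is the choice of the sign in front of the formulas. *)
Section Functions.
Variables (kg kn tg : R -> R) (b : bool).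

Definition mu (s : R) : R :=
  (-1) ^+ b *
  (kg s ^+ 2 / (kg s ^+ 2 - tg s ^+ 2) `^ (3 / 2) *
     derive1 (fun t => tg t / kg t) s
   - kn s / (kg s ^+ 2 - tg s ^+ 2) `^ (1 / 2)).

Definition eta : R -> R := mu.

(* The two terms have the same sign here, unlike in mu: they come from
     <B,d> / l = kg^2 (tg/kg)' / (kg^2 - tg^2) - kn,
   where d = l (tg T - kg N) + <B,d> B, and kg^2 - tg^2 < 0 in this case.
   With - kn instead of + kn the characterization of helices fails. *)
Definition psi (s : R) : R :=
  - (-1) ^+ b *
  (kg s ^+ 2 / (tg s ^+ 2 - kg s ^+ 2) `^ (3 / 2) *
     derive1 (fun t => tg t / kg t) s
   + kn s / (tg s ^+ 2 - kg s ^+ 2) `^ (1 / 2)).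

End Functions.

Section Constancy.
Variables (I : set R) (kg kn tg : R -> R).

Definition mu_constant (alpha : R) : Prop :=
  (forall s, I s -> tg s ^+ 2 < kg s ^+ 2) /\
  exists b, forall s, I s -> tanh alpha = mu kg kn tg b s.

Definition eta_constant (beta : R) : Prop :=
  [/\ forall s, I s -> tg s ^+ 2 < kg s ^+ 2, beta != 0
    & exists b, forall s, I s -> coth beta = eta kg kn tg b s].

Definition psi_constant (theta : R) : Prop :=
  [/\ forall s, I s -> kg s ^+ 2 < tg s ^+ 2, sin theta != 0
    & exists b, forall s, I s -> cot theta = psi kg kn tg b s].

End Constancy.

End Minkowski.

(* Main.v *)
(* If [<B,d>] is a constant [c], then [B' = -kg T + tg N] puts [d] in the form
   [l (tg T - kg N) + c B].  Differentiating the components of [d] shows that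
   its being constant amounts to two equations,
     [l^2 (kg^2 - tg^2) = c^2 - <d,d>],
     [c = l * slant], where [slant = kg^2 (tg/kg)' / (kg^2 - tg^2) - kn].
   The first determines [l] up to a sign, which is constant because [l] is
   continuous and never vanishes.  Substituted in the second, it says that
   [c / w = ± slant / sqrt |kg^2 - tg^2|] where [w^2 = |c^2 - <d,d>|]; this
   function is [± mu] when [kg^2 > tg^2] and [± psi] when [kg^2 < tg^2]. *)

Require Import Defs.
From HB Require Import structures.
From mathcomp Require Import all_boot all_order all_algebra.
From mathcomp Require Import all_classical all_reals all_analysis.
From mathcomp Require Import ring lra.

Set Implicit Arguments.
Unset Strict Implicit.
Unset Printing Implicit Defensive.

Import Order.TTheory GRing.Theory Num.Theory.
Import numFieldNormedType.Exports.

Local Open Scope classical_set_scope.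
Local Open Scope ring_scope.

(** * Derivatives of scalar functions on an interval *)

Section ScalarDerivatives.
Context {R : realType}.
Implicit Types (f g : R -> R) (I : set R) (s df dg : R).

Lemma is_derive_add f g s df dg : is_derive s 1 f df -> is_derive s 1 g dg ->
  is_derive s 1 (fun t => f t + g t) (df + dg).
Proof. exact: is_deriveD. Qed.

Lemma is_derive_sub f g s df dg : is_derive s 1 f df -> is_derive s 1 g dg ->
  is_derive s 1 (fun t => f t - g t) (df - dg).
Proof. exact: is_deriveB. Qed.

Lemma is_derive_mul f g s df dg : is_derive s 1 f df -> is_derive s 1 g dg ->
  is_derive s 1 (fun t => f t * g t) (df * g s + f s * dg).
Proof.
move=> Df Dg; apply: (is_derive_eq (is_deriveM Df Dg)).
by rewrite addrC [df * _]mulrC.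
Qed.

Lemma is_derive_coord m n (F : R -> 'M[R]_(m, n)) s dF i j :
  is_derive s 1 F dF -> is_derive s 1 (fun t => F t i j) (dF i j).
Proof.
move=> [DF <-]; rewrite (derive_mx DF) mxE.
by apply/derivableP; move/derivable_mxP: DF.
Qed.

(** [f] is constant only on [I], while the derivative is two-sided even at an end point. Along small
    steps towards another point of [I] the difference quotient is zero, so its limit cannot be
    nonzero. *)
Lemma derive_constant_on I f s df c : nondegenerate_interval I -> I s ->
  (forall t, I t -> f t = c) -> is_derive s 1 f df -> df = 0.
Proof.
move=> [itvI [a [b [Ia Ib ab]]]] Is fc [Df Ddf].
have [t It ts] : exists2 t, I t & t != s.
  case: (eqVneq a s) => [as_|]; last by exists a.
  by exists b => //; rewrite -as_ gt_eqF.
apply/eqP; apply: contraT => df0.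
have : (fun h => h^-1 *: (f (h *: 1 + s) - f s)) @ 0^' --> df.
  by rewrite -Ddf; exact: Df.
move=> /cvgr_neq0 /(_ df0) [e /= e0 He].
(* [k <= 1] keeps [k * (t - s) + s] between [s] and [t], hence in [I]; the factor 2 makes the step
   strictly shorter than [e]. *)
pose k := Num.min 1 (e / (2 * `|t - s|)).
have nts : 0 < `|t - s| by rewrite normr_gt0 subr_eq0.
have k0 : 0 < k by rewrite lt_min ltr01 divr_gt0 // mulr_gt0.
have k1 : k <= 1 by rewrite ge_min lexx.
have ke : k * `|t - s| < e.
  have : k <= e / (2 * `|t - s|) by rewrite ge_min lexx orbT.
  by rewrite ler_pdivlMr ?mulr_gt0 // => ?; lra.
have Iks : I (k * (t - s) + s).
  case: (ltgtP t s) => st; last by rewrite st eqxx in ts.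
    by apply: (itvI t s) => //; apply/andP; split; nra.
  by apply: (itvI s t) => //; apply/andP; split; nra.
have kts0 : k * (t - s) != 0 by rewrite mulf_neq0 ?subr_eq0 // gt_eqF.
have := He (k * (t - s)); rewrite /= sub0r normrN normrM (gtr0_norm k0).
move=> /(_ ke kts0).
by rewrite [_ *: 1]mulr1 !fc // subrr scaler0 eqxx.
Qed.

Lemma derive0_constant_on I f : is_interval I ->
  (forall s, I s -> is_derive s 1 f 0) -> forall s t, I s -> I t -> f s = f t.
Proof.
move=> itvI Df.
suff H s t : I s -> I t -> s < t -> f s = f t.
  move=> s t Is It; case: (ltgtP s t) => [st|ts|->] //; first exact: H.
  by apply/esym/H.
move=> Is It st.
have sub x : x \in `[s, t] -> I x.
  by rewrite in_itv /= => xst; apply: (itvI s t).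
have [||x _] := @MVT R f (fun=> 0) s t st.
- by move=> x xst; apply/Df/sub; apply: subset_itv_oo_cc.
- by apply: derivable_within_continuous => x /sub /Df [].
- by rewrite mul0r => /eqP; rewrite subr_eq0 => /eqP.
Qed.

Lemma sign_constant_on I f : is_interval I ->
  (forall s, I s -> derivable f s 1) -> (forall s, I s -> f s != 0) ->
  exists b : bool, forall s, I s -> 0 < (-1) ^+ b * f s.
Proof.
move=> itvI Df f0.
have [[s0 Is0]|I0] := pselect (exists s, I s); last first.
  by exists false => s Is; case: I0; exists s.
have H s t : I s -> I t -> s < t -> 0 < f s * f t.
  move=> Is It st; rewrite ltNge; apply/negP => st0.
  have sub x : x \in `[s, t] -> I x.
    by rewrite in_itv /= => xst; apply: (itvI s t).
  have [||x /sub /f0 /eqP //] := @IVT R f s t 0 (ltW st).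
    by apply: derivable_within_continuous => x /sub /Df.
  have := f0 _ Is; have := f0 _ It.
  by rewrite ge_min le_max; case: (ltgtP (f s) 0);
    case: (ltgtP (f t) 0) => //; nra.
exists (f s0 < 0) => s Is.
have : 0 < f s0 * f s.
  case: (ltgtP s0 s) => [st|st|<-]; [exact: H|by rewrite mulrC; exact: H|].
  by rewrite -expr2 exprn_even_gt0 //= f0.
by have := f0 _ Is0; case: (ltgtP (f s0) 0) => //= ? _;
  rewrite ?mul1r ?mulN1r; nra.
Qed.

End ScalarDerivatives.

(** * Algebra of the Lorentzian inner and cross products *)

Section LorentzAlgebra.
Context {R : realType}.
Implicit Types (u v w x y : 'rV[R]_3) (a b : R).

Lemma lorentzC u v : lorentz u v = lorentz v u.
Proof. by rewrite /lorentz; ring. Qed.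

Lemma lorentzDl u v w : lorentz (u + v) w = lorentz u w + lorentz v w.
Proof. by rewrite /lorentz !mxE; ring. Qed.

Lemma lorentzZl a u w : lorentz (a *: u) w = a * lorentz u w.
Proof. by rewrite /lorentz !mxE; ring. Qed.

Lemma lorentzDr u v w : lorentz w (u + v) = lorentz w u + lorentz w v.
Proof. by rewrite !(lorentzC w) lorentzDl. Qed.

Lemma lorentzZr a u w : lorentz w (a *: u) = a * lorentz w u.
Proof. by rewrite !(lorentzC w) lorentzZl. Qed.

Lemma lorentz_lcrossl x y : lorentz (lcross x y) x = 0.
Proof. by rewrite /lorentz /lcross !mxE /=; ring. Qed.

Lemma lorentz_lcrossr x y : lorentz (lcross x y) y = 0.
Proof. by rewrite /lorentz /lcross !mxE /=; ring. Qed.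

(** Lagrange's identity; the Lorentzian signature reverses its Euclidean sign. *)
Lemma lorentz_lcross x y :
  lorentz (lcross x y) (lcross x y) =
  lorentz x y ^+ 2 - lorentz x x * lorentz y y.
Proof. by rewrite /lorentz /lcross !mxE /=; ring. Qed.

(* [<x × y, d>^2] is minus the Gram determinant of [x], [y], [d]. *)
Lemma lorentz_lcross_sqr x y d :
  lorentz (lcross x y) d ^+ 2 =
  - (lorentz x x * (lorentz y y * lorentz d d - lorentz y d ^+ 2)
     - lorentz x y * (lorentz x y * lorentz d d - lorentz y d * lorentz x d)
     + lorentz x d * (lorentz x y * lorentz y d - lorentz y y * lorentz x d)).
Proof. by rewrite /lorentz /lcross !mxE /=; ring. Qed.

Lemma is_derive_lorentz (F G : R -> 'rV[R]_3) (s : R) dF dG :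
  is_derive s 1 F dF -> is_derive s 1 G dG ->
  is_derive s 1 (fun t => lorentz (F t) (G t))
    (lorentz dF (G s) + lorentz (F s) dG).
Proof.
move=> DF DG.
have c i := is_derive_mul (is_derive_coord 0 i DF) (is_derive_coord 0 i DG).
apply: (is_derive_eq (is_derive_add (is_derive_add
  (is_deriveN (c 0)) (c 1)) (c 2))).
by rewrite /lorentz; ring.
Qed.

Lemma is_derive_lorentzl (F : R -> 'rV[R]_3) d (s : R) dF :
  is_derive s 1 F dF ->
  is_derive s 1 (fun t => lorentz (F t) d) (lorentz dF d).
Proof.
move=> DF; apply: (is_derive_eq (is_derive_lorentz DF (is_derive_cst d _ _))).
by rewrite /lorentz !mxE; ring.
Qed.

End LorentzAlgebra.

(** * The Darboux frame and the axis of a helix *)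

Section DarbouxFrame.
Context {R : realType} (I : set R) (T N : R -> 'rV[R]_3) (kg kn tg : R -> R).
Let B s := lcross (N s) (T s).
Hypothesis I_itv : nondegenerate_interval I.
Hypothesis TT : forall s, I s -> lorentz (T s) (T s) = 1.
Hypothesis NN : forall s, I s -> lorentz (N s) (N s) = -1.
Hypothesis DT : forall s, I s ->
  is_derive s 1 T (kg s *: B s + kn s *: N s).
Hypothesis DB : forall s, I s ->
  is_derive s 1 B (- kg s *: T s + tg s *: N s).
Hypothesis DN : forall s, I s ->
  is_derive s 1 N (kn s *: T s + tg s *: B s).
Hypothesis Dkg : forall s, I s -> derivable kg s 1.
Hypothesis Dtg : forall s, I s -> derivable tg s 1.
Hypothesis kg0 : forall s, I s -> kg s != 0.
Hypothesis kg2Dtg2 : forall s, I s -> kg s ^+ 2 - tg s ^+ 2 != 0.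

(* Differentiating [<B,T> = 0] and [<B,N> = 0] already forces [<N,T> = 0]. *)
Lemma frame_orthogonal s : I s -> lorentz (N s) (T s) = 0.
Proof.
move=> Is.
have BT t : I t -> lorentz (B t) (T t) = 0 by rewrite lorentz_lcrossr.
have BN t : I t -> lorentz (B t) (N t) = 0 by rewrite lorentz_lcrossl.
have := derive_constant_on I_itv Is BT (is_derive_lorentz (DB Is) (DT Is)).
have := derive_constant_on I_itv Is BN (is_derive_lorentz (DB Is) (DN Is)).
rewrite !(lorentzDl, lorentzDr, lorentzZl, lorentzZr) BT // BN // TT // NN //.
rewrite (lorentzC (T s)) lorentz_lcross TT // NN //.
set p := lorentz _ _ => EN ET.
have {}EN : tg s * p ^+ 2 = kg s * p by lra.
have {}ET : kg s * p ^+ 2 = - (tg s * p) by lra.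
have p1 : 1 + p ^+ 2 != 0 by rewrite gt_eqF //; nra.
(* The two relations eliminate [tg]: [kg s * p ^+ 3 = - tg s * p ^+ 2 = - kg s * p]. *)
have : kg s * (1 + p ^+ 2) * p = 0.
  by transitivity (kg s * p + kg s * p ^+ 2 * p); [|rewrite ET -EN]; ring.
by move=> /eqP; rewrite !mulf_eq0 (negbTE (kg0 Is)) (negbTE p1) => /eqP.
Qed.

Definition slant s : R :=
  kg s ^+ 2 * derive1 (fun t => tg t / kg t) s / (kg s ^+ 2 - tg s ^+ 2) - kn s.


(** As [N] and [T] are orthogonal, the Gram determinant identity for [B] gives this without
    expanding [d] in the frame. *)
Lemma frame_norm s d : I s ->
  lorentz d d =
  lorentz (T s) d ^+ 2 + lorentz (B s) d ^+ 2 - lorentz (N s) d ^+ 2.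
Proof.
by move=> Is; rewrite lorentz_lcross_sqr frame_orthogonal // TT // NN //; ring.
Qed.

Lemma slantE s : I s ->
  (kg s ^+ 2 - tg s ^+ 2) * slant s =
  derive1 tg s * kg s - tg s * derive1 kg s
  - (kg s ^+ 2 - tg s ^+ 2) * kn s.
Proof.
move=> Is; have kgs0 := kg0 Is; have Ds0 := kg2Dtg2 Is.
have [Vkg DVkg] := is_deriveV kgs0 (derivableP (Dkg Is)).
have := is_derive_mul (derivableP (Dtg Is)) (DeriveDef Vkg DVkg).
move=> [_]; rewrite /slant derive1E => ->; rewrite !derive1E /GRing.scale /=.
by field; rewrite ?kgs0 ?Ds0.
Qed.

(** The function [l] is [<N,d> / kg]. Differentiating [<B,d> = c] gives [kg <T,d> = tg <N,d>]; this
    relation turns [frame_norm] into the first equation, and its own derivative is the second. *)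
Lemma helix_slant d c : lorentz d d != 0 ->
  (forall s, I s -> lorentz (B s) d = c) ->
  exists (l : R -> R) (b : bool), forall s, I s ->
    [/\ 0 < (-1) ^+ b * l s,
        l s ^+ 2 * (kg s ^+ 2 - tg s ^+ 2) = c ^+ 2 - lorentz d d
      & c = l s * slant s].
Proof.
move=> d0 Bd.
pose x s := lorentz (T s) d; pose z s := lorentz (N s) d.
have Dx s : I s -> is_derive s 1 x (kg s * c + kn s * z s).
  move=> Is; apply: (is_derive_eq (is_derive_lorentzl d (DT Is))).
  by rewrite lorentzDl !lorentzZl Bd.
have Dz s : I s -> is_derive s 1 z (kn s * x s + tg s * c).
  move=> Is; apply: (is_derive_eq (is_derive_lorentzl d (DN Is))).
  by rewrite lorentzDl !lorentzZl Bd.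
have xz s : I s -> kg s * x s - tg s * z s = 0.
  move=> Is.
  have := derive_constant_on I_itv Is Bd (is_derive_lorentzl d (DB Is)).
  by rewrite lorentzDl !lorentzZl /x /z => E; lra.
have key s : I s -> kg s * c = z s * slant s.
  move=> Is.
  have := derive_constant_on I_itv Is xz
    (is_derive_sub (is_derive_mul (derivableP (Dkg Is)) (Dx _ Is))
                   (is_derive_mul (derivableP (Dtg Is)) (Dz _ Is))).
  move: (slantE Is) (xz _ Is); rewrite -!derive1E.
  set D := (kg s ^+ 2 - _) => E1 E2 E3.
  apply: (mulfI (kg2Dtg2 Is)); rewrite -/D mulrCA [RHS]mulrCA E1 /D.
  apply: (mulfI (kg0 Is)).
  (* These multiples of [E3] and [E2] cancel [x s]. *)
  have := congr1 ( *%R (kg s * kg s)) E3.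
  have := congr1 ( *%R (kg s * (derive1 kg s - tg s * kn s))) E2.
  by rewrite !mulr0 => F2 F3; lra.
have norm s : I s -> z s ^+ 2 * (kg s ^+ 2 - tg s ^+ 2) =
    kg s ^+ 2 * (c ^+ 2 - lorentz d d).
  move=> Is; rewrite (frame_norm d Is) Bd // -/(x s) -/(z s).
  have := congr1 ( *%R (kg s * x s + tg s * z s)) (xz _ Is).
  by rewrite mulr0 => F; lra.
(* [z s = 0] forces [c = 0] by [key]; then [norm] gives [<d,d> = 0], contrary to [d0]. *)
have z0 s : I s -> z s != 0.
  move=> Is; apply: contra d0 => /eqP zs0.
  have /eqP := key _ Is; rewrite zs0 mul0r mulf_eq0 (negbTE (kg0 Is)) /=.
  move=> /eqP c0; have /eqP := norm _ Is.
  rewrite zs0 c0 !expr0n /= mul0r sub0r eq_sym mulf_eq0 oppr_eq0 => /orP[|//].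
  by rewrite expf_eq0 /= (negbTE (kg0 Is)).
(* [kg * z] has the sign of [z / kg] and is differentiable by the product rule alone. *)
have [b zb] : exists b : bool, forall s, I s -> 0 < (-1) ^+ b * (kg s * z s).
  apply: sign_constant_on I_itv.1 _ _ => s Is;
    last by rewrite mulf_neq0 ?kg0 ?z0.
  by have [] := is_derive_mul (derivableP (Dkg Is)) (Dz _ Is).
exists (fun s => z s / kg s), b => s Is; have kgs0 := kg0 Is; split.
- have -> : (-1) ^+ b * (z s / kg s) =
      (-1) ^+ b * (kg s * z s) / kg s ^+ 2 :> R.
    by field.
  by rewrite divr_gt0 ?zb // exprn_even_gt0.
- by rewrite expr_div_n mulrAC norm // mulrAC divff ?mul1r // expf_neq0.
- by rewrite mulrAC -key // mulrC mulKf.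
Qed.

(** The axis is built from the frame at every point, and its derivative vanishes: the [B] component
    cancels because [X * kg = Z * tg], the [T] and [N] components by [dX]. *)
Lemma slant_helix (l : R -> R) k c s0 :
  I s0 -> (forall s, I s -> derivable l s 1) -> (forall s, I s -> l s != 0) ->
  (forall s, I s -> l s ^+ 2 * (kg s ^+ 2 - tg s ^+ 2) = k) ->
  (forall s, I s -> c = l s * slant s) ->
  exists d, lorentz d d = c ^+ 2 - k /\ forall s, I s -> lorentz (B s) d = c.
Proof.
move=> Is0 Dl l0 lk cl.
pose X t := l t * tg t; pose Z t := l t * kg t.
have DX s Is := is_derive_mul (derivableP (Dl s Is)) (derivableP (Dtg Is)).
have DZ s Is := is_derive_mul (derivableP (Dl s Is)) (derivableP (Dkg Is)).
pose d t := X t *: T t + c *: B t - Z t *: N t.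
have BT s : lorentz (B s) (T s) = 0 by exact: lorentz_lcrossr.
have BN s : lorentz (B s) (N s) = 0 by exact: lorentz_lcrossl.
have BB s : I s -> lorentz (B s) (B s) = 1.
  by move=> Is; rewrite lorentz_lcross frame_orthogonal // NN // TT //; ring.
have Bd s : I s -> lorentz (B s) (d s) = c.
  move=> Is; rewrite /d -scaleNr !lorentzDr !lorentzZr BT BN BB //; ring.
(* Both follow, after multiplication by [kg^2 - tg^2], from the derivative of [lk] and from [slantE]
   multiplied by [l]. *)
have dX s : I s ->
    derive1 l s * tg s + l s * derive1 tg s = kg s * c + kn s * Z s /\
    derive1 l s * kg s + l s * derive1 kg s = kn s * X s + tg s * c.
  move=> Is; have Ds0 := kg2Dtg2 Is.
  have DD := is_derive_sub
    (is_derive_mul (derivableP (Dkg Is)) (derivableP (Dkg Is)))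
    (is_derive_mul (derivableP (Dtg Is)) (derivableP (Dtg Is))).
  have := derive_constant_on I_itv Is lk (is_derive_mul
    (is_derive_mul (derivableP (Dl _ Is)) (derivableP (Dl _ Is))) DD).
  rewrite -!derive1E => E.
  have {}E : derive1 l s * (kg s ^+ 2 - tg s ^+ 2) =
      - l s * (kg s * derive1 kg s - tg s * derive1 tg s).
    apply: (mulfI (l0 _ Is)); lra.
  have := congr1 ( *%R (l s)) (slantE Is); rewrite mulrCA -cl // => F.
  split; apply: (mulIf Ds0); rewrite mulrDl mulrAC E /X /Z.
    by have := congr1 ( *%R (kg s)) F; lra.
  by have := congr1 ( *%R (tg s)) F; lra.
have d_const s : I s -> d s0 = d s.
  move=> Is; apply/rowP => i.
  apply: (derive0_constant_on I_itv.1 (f := fun t => d t 0 i)) => // t It.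
  have Dd := is_derive_sub (is_derive_add
    (is_derive_mul (DX t It) (is_derive_coord 0 i (DT It)))
    (is_derive_mul (is_derive_cst c t 1) (is_derive_coord 0 i (DB It))))
    (is_derive_mul (DZ t It) (is_derive_coord 0 i (DN It))).
  have -> : (fun t => d t 0 i) =
      fun t => X t * T t 0 i + c * B t 0 i - Z t * N t 0 i.
    by apply/funext => u; rewrite /d !mxE.
  apply: (is_derive_eq Dd); rewrite -!derive1E.
  have [-> ->] := dX t It; move: (B t) => b; rewrite !mxE /X /Z /=; ring.
exists (d s0); split=> [|s Is]; last by rewrite (d_const s) // Bd.
rewrite (frame_norm _ Is0) Bd // -(lk _ Is0).
rewrite /d -scaleNr !lorentzDr !lorentzZr.
rewrite !(lorentzC (T s0)) !(lorentzC (N s0) (B s0)) BT BN TT // NN //.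
rewrite frame_orthogonal // /X /Z; ring.
Qed.
(** Taking square roots in [l^2 (kg^2 - tg^2) = c^2 - <d,d>] replaces [l] by [w]. The same equation
    gives [kg^2 - tg^2] the sign of [c^2 - <d,d>], which separates [psi] from [mu] and [eta]. *)
Lemma helix_ratio d c w : lorentz d d != 0 ->
  (forall s, I s -> lorentz (B s) d = c) ->
  w ^+ 2 = `|c ^+ 2 - lorentz d d| ->
  [/\ w != 0,
      forall s, I s -> 0 < (kg s ^+ 2 - tg s ^+ 2) * (c ^+ 2 - lorentz d d)
    & exists b : bool, forall s, I s ->
        c / w = (-1) ^+ b / Num.sqrt `|kg s ^+ 2 - tg s ^+ 2| * slant s].
Proof.
move=> d0 Bd wE; have [l [b lb]] := helix_slant d0 Bd.
have DK s : I s -> 0 < (kg s ^+ 2 - tg s ^+ 2) * (c ^+ 2 - lorentz d d).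
  move=> Is; have [lpos <- _] := lb s Is; rewrite mulrCA -expr2.
  rewrite mulr_gt0 // exprn_even_gt0 //= ?kg2Dtg2 //.
  by apply: contraTneq lpos => ->; rewrite mulr0 ltxx.
(* [w = 0] would mean [c^2 = <d,d>], against [DK] at a point of [I]. For [w] equal to [sinh beta] or
   [sin theta] this keeps [coth] and [cot] meaningful. *)
have w0 : w != 0.
  have [_ [s [_ [Is _ _]]]] := I_itv; have := DK s Is.
  apply: contraTneq => w0; move: wE; rewrite w0 expr0n => /esym/eqP.
  by rewrite normr_eq0 => /eqP ->; rewrite mulr0 ltxx.
(* [w] may be negative, as [sinh beta] and [sin theta] may; its sign is combined with the sign [b]
   of [l]. *)
split=> //; exists (b (+) (w < 0)) => s Is.
have [lpos lD cl] := lb s Is.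
set r := Num.sqrt _.
have r0 : 0 < r by rewrite sqrtr_gt0 normr_gt0 kg2Dtg2.
have wpos : 0 < (-1) ^+ (w < 0)%R * w :> R.
  by move: w0; case: (ltgtP w 0) => //= ? _;
    rewrite ?expr1 ?mulN1r ?mul1r ?oppr_gt0.
have : (-1) ^+ b * l s * r = (-1) ^+ (w < 0)%R * w.
  apply: (@pexpIrn _ 2) => //; [exact/ltW/mulr_gt0|exact: ltW|].
  rewrite !exprMn !sqrr_sign !mul1r.
  by rewrite wE -lD sqr_sqrtr // normrM ger0_norm ?sqr_ge0.
rewrite signr_addb => E; rewrite {1}cl.
have -> : l s = (-1) ^+ b * ((-1) ^+ b * l s * r) / r.
  by rewrite mulrA mulfK ?gt_eqF // mulrA -expr2 sqrr_sign mul1r.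
by rewrite E; field; rewrite w0 gt_eqF.
Qed.

(** Here [e] is the sign of [kg^2 - tg^2], so that one argument serves all three functions. *)
Lemma ratio_helix e c w (b : bool) : e ^+ 2 = 1 -> w != 0 ->
  (forall s, I s -> 0 < e * (kg s ^+ 2 - tg s ^+ 2)) ->
  (forall s, I s ->
     c / w = (-1) ^+ b / Num.sqrt (e * (kg s ^+ 2 - tg s ^+ 2)) * slant s) ->
  exists d, lorentz d d = c ^+ 2 - e * w ^+ 2 /\
            forall s, I s -> lorentz (B s) d = c.
Proof.
move=> e2 w0 eD ratio; have [_ [s0 [_ [Is0 _ _]]]] := I_itv.
pose D s := e * (kg s ^+ 2 - tg s ^+ 2).
(* Chosen so that the given ratio, multiplied by [w], reads [c = l s * slant s]; since [e^-1 = e],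
   also [l^2 (kg^2 - tg^2) = e w^2]. *)
pose l s := (-1) ^+ b * w * (Num.sqrt (D s))^-1.
have r0 s : I s -> Num.sqrt (D s) != 0.
  by move=> Is; rewrite gt_eqF // sqrtr_gt0 eD.
apply: (slant_helix (l := l) (k := e * w ^+ 2) Is0) => s Is.
- have DD := is_derive_mul (is_derive_cst e s 1) (is_derive_sub
    (is_derive_mul (derivableP (Dkg Is)) (derivableP (Dkg Is)))
    (is_derive_mul (derivableP (Dtg Is)) (derivableP (Dtg Is)))).
  have Dr := @is_derive1_comp R Num.sqrt D s _ _
    (is_derive1_sqrt (eD _ Is)) DD.
  by have [] := is_derive_mul (is_derive_cst ((-1) ^+ b * w) s 1)
    (@is_deriveV R (Num.sqrt \o D) s _ _ (r0 _ Is) Dr).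
- by rewrite !mulf_neq0 ?invr_eq0 ?signr_eq0 ?r0.
- rewrite !exprMn sqrr_sign mul1r exprVn sqr_sqrtr; last exact/ltW/eD.
  have e0 : e != 0 by apply: contra_eq_neq e2 => ->;
    rewrite expr0n eq_sym oner_eq0.
  have eV : e^-1 = e by apply: (mulfI e0); rewrite divff // -expr2.
  by have D0 := kg2Dtg2 Is; rewrite invfM eV; field.
- have := ratio s Is => /(congr1 ( *%R w)); rewrite mulrCA divff // mulr1 => ->.
  by rewrite /l; ring.
Qed.

End DarbouxFrame.

(** * The functions [mu] and [psi] in terms of [slant] *)

Section CurvatureFunctions.
Context {R : realType} (kg kn tg : R -> R).

Lemma powR32 (x : R) : 0 < x -> x `^ (3 / 2) = x * Num.sqrt x.
Proof.
move=> x0; have -> : 3 / 2 = 1 + 2^-1 :> R by field.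
by rewrite powRD ?(gt_eqF x0) ?implybT // powRr1 ?powR12_sqrt // ltW.
Qed.

Lemma muE b s : tg s ^+ 2 < kg s ^+ 2 ->
  mu kg kn tg b s =
  (-1) ^+ b / Num.sqrt (kg s ^+ 2 - tg s ^+ 2) * slant kg kn tg s.
Proof.
move=> D; have D0 : 0 < kg s ^+ 2 - tg s ^+ 2 by rewrite subr_gt0.
rewrite /mu powR32 // mul1r powR12_sqrt ?ltW // /slant.
field.
by rewrite !gt_eqF ?sqrtr_gt0.
Qed.

(** Writing [tg^2 - kg^2] as the opposite of [kg^2 - tg^2] outside the root changes the sign of the
    derivative term only; with [+ kn], the leading minus of [psi] then produces [slant]. *)
Lemma psiE b s : kg s ^+ 2 < tg s ^+ 2 ->
  psi kg kn tg b s =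
  (-1) ^+ b / Num.sqrt (tg s ^+ 2 - kg s ^+ 2) * slant kg kn tg s.
Proof.
move=> D; have D0 : 0 < tg s ^+ 2 - kg s ^+ 2 by rewrite subr_gt0.
rewrite /psi powR32 // mul1r powR12_sqrt ?ltW // /slant -(opprB (tg s ^+ 2)).
field.
by rewrite !gt_eqF ?sqrtr_gt0.
Qed.

End CurvatureFunctions.

(** * Hyperbolic functions: identities and ranges *)

Section Hyperbolic.
Context {R : realType}.
Implicit Types x c : R.

Lemma cosh2Bsinh2 x : cosh x ^+ 2 - sinh x ^+ 2 = 1.
Proof.
rewrite /cosh /sinh; transitivity (expR x * expR (- x)); first by field.
by rewrite expRxMexpNx_1.
Qed.

Lemma cosh_neq0 x : cosh x != 0.
Proof. by rewrite gt_eqF // divr_gt0 // addr_gt0 ?expR_gt0. Qed.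

Lemma sinh_neq0 x : (sinh x != 0) = (x != 0).
Proof.
rewrite /sinh mulf_eq0 invr_eq0 pnatr_eq0 orbF subr_eq0; congr negb.
by apply/eqP/eqP => [/expR_inj|->]; [lra|rewrite oppr0].
Qed.

Lemma sinh_surj c : exists x, sinh x = c.
Proof.
have r0 := sqr_ge0 c; set r := Num.sqrt (c ^+ 2 + 1).
have rE : r ^+ 2 = c ^+ 2 + 1 by rewrite sqr_sqrtr // addr_ge0.
have rge : 0 <= r := sqrtr_ge0 _.
have p : 0 < c + r by nra.
(* Logarithmic form of the inverse of [sinh]; multiplied by [c + r], the equation follows from
   [rE]. *)
exists (ln (c + r)); rewrite /sinh expRN lnK ?posrE //.
by apply: (mulIf (lt0r_neq0 p)); rewrite mulrAC mulrBl mulVf ?gt_eqF //; nra.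
Qed.

Lemma cosh_surj c : 1 <= c -> exists x, cosh x = c.
Proof.
move=> c1; set r := Num.sqrt (c ^+ 2 - 1).
have rE : r ^+ 2 = c ^+ 2 - 1 by rewrite sqr_sqrtr // subr_ge0 expr_ge1 //; lra.
have rge : 0 <= r := sqrtr_ge0 _.
have p : 0 < c + r by lra.
exists (ln (c + r)); rewrite /cosh expRN lnK ?posrE //.
by apply: (mulIf (lt0r_neq0 p)); rewrite mulrAC mulrDl mulVf ?gt_eqF //; nra.
Qed.

End Hyperbolic.

(** * Differentiability of smooth curves and of their cross product *)

Section SmoothCurves.
Context {R : realType}.

Lemma smooth_on_derivable (V : normedModType R) (A : set R) (f : R -> V) s :
  smooth_on A f -> A s -> derivable f s 1.
Proof.
by move=> [U [_ AU fC]] As; apply: diff_derivable; apply: (fC 1%N).1; exact: AU.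
Qed.

Lemma smooth_on_derive1 (V : normedModType R) (A : set R) (f : R -> V) :
  smooth_on A f -> smooth_on A (derive1 f).
Proof.
move=> [U [oU AU fC]]; exists U; split=> // k.
have -> : derive1 f = fun t => 'D_1 f t by apply/funext => t; rewrite derive1E.
exact: (fC k.+1).2.
Qed.

(** [derive1] has a value even without differentiability, so the Darboux equation for the derivative
    of [B] yields an [is_derive] fact only together with this lemma. *)
Lemma derivable_lcross (F G : R -> 'rV[R]_3) (s : R) :
  derivable F s 1 -> derivable G s 1 ->
  derivable (fun t => lcross (F t) (G t)) s 1.
Proof.
move=> /derivable_mxP DF /derivable_mxP DG; apply/derivable_mxP => i j.
have c k l : derivable (fun t => F t 0 k * G t 0 l - F t 0 l * G t 0 k) s 1.
  by apply: derivableB; apply: derivableM.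
have lcrossE (k : 'I_3) : (fun t => lcross (F t) (G t) i k) =
    fun t => [:: F t 0 1 * G t 0 2 - F t 0 2 * G t 0 1;
                 F t 0 0 * G t 0 2 - F t 0 2 * G t 0 0;
                 F t 0 1 * G t 0 0 - F t 0 0 * G t 0 1]`_k.
  by apply/funext => t; rewrite mxE.
by rewrite lcrossE; case: j => -[|[|[|//]]] j3; exact: c.
Qed.

End SmoothCurves.

(** The second conjunct ties the constants [alpha], [beta], [theta] to the angles between [B] and a
    given axis. It is proved first; the direct implication follows by writing [<B,d>] as a [sinh],
    [cosh] or [cos]. *)
Theorem theorem6p1 (R : realType) (I : set R) (M : set 'rV[R]_3)
    (gamma N : R -> 'rV[R]_3) (kg kn tg : R -> R)
    (I_itv : nondegenerate_interval I)
    (M_spacelike : spacelike_surface M)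
    (gamma_spacelike : unit_speed_spacelike I gamma)
    (gamma_on_M : forall s, I s -> M (gamma s))
    (N_normal : unit_normal_along I gamma N M)
    (n_spacelike : spacelike_principal_normal I gamma)
    (darboux : darboux_curvatures I gamma N kg kn tg)
    (kg_neq0 : forall s, I s -> kg s != 0)
    (kg2_neq_tg2 : forall s, I s -> kg s ^+ 2 != tg s ^+ 2) :
  (relatively_normal_slant_helix I gamma N <->
     [\/ exists alpha : R, mu_constant I kg kn tg alpha,
         exists beta : R, eta_constant I kg kn tg beta
       | exists theta : R, psi_constant I kg kn tg theta]) /\
  (forall d : 'rV[R]_3,
     [/\ forall alpha : R, lorentz d d = -1 ->
           (forall s, I s -> lorentz (binormal gamma N s) d = sinh alpha) ->
           mu_constant I kg kn tg alpha,
         forall beta : R, lorentz d d = 1 ->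
           (forall s, I s -> lorentz (binormal gamma N s) d = cosh beta) ->
           eta_constant I kg kn tg beta
       & forall theta : R, lorentz d d = 1 ->
           (forall s, I s -> lorentz (binormal gamma N s) d = cos theta) ->
           psi_constant I kg kn tg theta]).
Proof.
have [gammaS gammaT] := gamma_spacelike; have [NS NN] := N_normal.
have [kgS knS tgS frame] := darboux.
pose T := tangent gamma.
have TT s : I s -> lorentz (T s) (T s) = 1 by move=> /gammaT[].
have NN1 s : I s -> lorentz (N s) (N s) = -1.
  move=> /NN [[_ N1] Nt]; rewrite /timelike in Nt.
  by rewrite -N1 ltr0_norm ?opprK.
have dT s (Is : I s) := smooth_on_derivable (smooth_on_derive1 gammaS) Is.
have dN s (Is : I s) := smooth_on_derivable NS Is.
have Dkg s (Is : I s) := smooth_on_derivable kgS Is.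
have Dtg s (Is : I s) := smooth_on_derivable tgS Is.
have DT s : I s ->
    is_derive s 1 T (kg s *: lcross (N s) (T s) + kn s *: N s).
  move=> Is; have [<- _ _] := frame s Is.
  by rewrite derive1E; exact: derivableP (dT s Is).
have DB s : I s -> is_derive s 1 (fun t => lcross (N t) (T t))
    (- kg s *: T s + tg s *: N s).
  move=> Is; have [_ <- _] := frame s Is.
  rewrite derive1E; exact: derivableP (derivable_lcross (dN s Is) (dT s Is)).
have DN s : I s ->
    is_derive s 1 N (kn s *: T s + tg s *: lcross (N s) (T s)).
  move=> Is; have [_ _ <-] := frame s Is.
  by rewrite derive1E; exact: derivableP (dN s Is).
have D0 s : I s -> kg s ^+ 2 - tg s ^+ 2 != 0.
  by move=> Is; rewrite subr_eq0 kg2_neq_tg2.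
have ratio := helix_ratio I_itv TT NN1 DT DB DN Dkg Dtg kg_neq0 D0.
have helix := ratio_helix I_itv TT NN1 DT DB DN Dkg Dtg kg_neq0 D0.
have muP d alpha : lorentz d d = -1 ->
    (forall s, I s -> lorentz (binormal gamma N s) d = sinh alpha) ->
    mu_constant I kg kn tg alpha.
  (* With [w = cosh alpha] the quotient [c / w] is [tanh alpha], and [c^2 - <d,d> > 0] yields
     [kg^2 > tg^2]. *)
  move=> d1 Bd; have K : sinh alpha ^+ 2 - lorentz d d = cosh alpha ^+ 2.
    by rewrite d1 -(cosh2Bsinh2 alpha); ring.
  have d0 : lorentz d d != 0 by rewrite d1 oppr_eq0 oner_eq0.
  have [|_ Dpos [b bE]] := ratio d _ (cosh alpha) d0 Bd.
    by rewrite K ger0_norm ?sqr_ge0.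
  have kt s : I s -> tg s ^+ 2 < kg s ^+ 2.
    move=> /Dpos; rewrite K pmulr_lgt0 ?subr_gt0 //.
    by rewrite exprn_even_gt0 //= cosh_neq0.
  split=> //; exists b => s Is; rewrite muE ?kt // /tanh (bE _ Is).
  by rewrite gtr0_norm // subr_gt0 kt.
have etaP d beta : lorentz d d = 1 ->
    (forall s, I s -> lorentz (binormal gamma N s) d = cosh beta) ->
    eta_constant I kg kn tg beta.
  move=> d1 Bd; have K : cosh beta ^+ 2 - lorentz d d = sinh beta ^+ 2.
    by rewrite d1 -(cosh2Bsinh2 beta); ring.
  have d0 : lorentz d d != 0 by rewrite d1 oner_eq0.
  have [|w0 Dpos [b bE]] := ratio d _ (sinh beta) d0 Bd.
    by rewrite K ger0_norm ?sqr_ge0.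
  have kt s : I s -> tg s ^+ 2 < kg s ^+ 2.
    move=> /Dpos; rewrite K pmulr_lgt0 ?subr_gt0 //.
    by rewrite exprn_even_gt0.
  split=> //; first by rewrite -sinh_neq0.
  exists b => s Is; rewrite /Defs.eta muE ?kt // /coth (bE _ Is).
  by rewrite gtr0_norm // subr_gt0 kt.
have psiP d theta : lorentz d d = 1 ->
    (forall s, I s -> lorentz (binormal gamma N s) d = cos theta) ->
    psi_constant I kg kn tg theta.
  move=> d1 Bd; have K : cos theta ^+ 2 - lorentz d d = - sin theta ^+ 2.
    by rewrite d1 sin2cos2; ring.
  have d0 : lorentz d d != 0 by rewrite d1 oner_eq0.
  have [|w0 Dpos [b bE]] := ratio d _ (sin theta) d0 Bd.
    by rewrite K normrN ger0_norm ?sqr_ge0.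
  have kt s : I s -> kg s ^+ 2 < tg s ^+ 2.
    move=> /Dpos; rewrite K mulrN -mulNr opprB pmulr_lgt0 ?subr_gt0 //.
    by rewrite exprn_even_gt0.
  split=> //; exists b => s Is; rewrite psiE ?kt // /cot (bE _ Is).
  by rewrite distrC gtr0_norm // subr_gt0 kt.
split; last by move=> d; split; [exact: muP|exact: etaP|exact: psiP].
split=> [[d [c [[d1|d1] Bd]]]|].
(* The borderline [|c| = 1] falls under [cosh], where [etaP] excludes [beta = 0]. *)
- have [c1|c1] := leP 1 `|c|.
    have [beta betaE] := cosh_surj c1.
    apply: Or32; exists beta.
    case: (leP 0 c) betaE => [c0|c0].
      by rewrite ger0_norm // => cE; apply: (etaP d) => // s Is; rewrite cE Bd.
    (* [cosh] is positive, so a negative [c] requires the opposite axis. *)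
    rewrite ltr0_norm // => cE; apply: (etaP (-1 *: d)) => [|s Is].
      by rewrite lorentzZl lorentzZr d1; ring.
    by rewrite lorentzZr Bd // cE mulN1r.
  apply: Or33; exists (acos c); apply: (psiP d) => // s Is.
  by rewrite Bd // acosK // in_itv /= -ler_norml ltW.
- have [alpha alphaE] := sinh_surj c.
  by apply: Or31; exists alpha; apply: (muP d) => // s Is; rewrite alphaE Bd.
(* Conversely, [e] is 1 for [mu] and [eta] and -1 for [psi]; [<d,d> = c^2 - e w^2] is then
   [sinh^2 - cosh^2], [cosh^2 - sinh^2] or [cos^2 + sin^2], so [d] is a unit vector. *)
- case=> [[alpha [kt [b bE]]]|[beta [kt b0 [b bE]]]|[theta [kt s0 [b bE]]]].
  + have [s Is|s Is|d [d1 Bd]] :=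
      helix 1 (sinh alpha) (cosh alpha) b (expr1n _ _) (cosh_neq0 _).
    * by rewrite mul1r subr_gt0 kt.
    * by rewrite mul1r -muE ?kt //; exact: bE.
    exists d, (sinh alpha); split=> //; right.
    by rewrite d1; have := cosh2Bsinh2 alpha; lra.
  + have [||s Is|s Is|d [d1 Bd]] := helix 1 (cosh beta) (sinh beta) b.
    * exact: expr1n.
    * by rewrite sinh_neq0.
    * by rewrite mul1r subr_gt0 kt.
    * by rewrite mul1r -muE ?kt //; exact: bE.
    exists d, (cosh beta); split=> //; left.
    by rewrite d1; have := cosh2Bsinh2 beta; lra.
  + have [|s Is|s Is|d [d1 Bd]] := helix (-1) (cos theta) (sin theta) b _ s0.
    * by rewrite sqrrN expr1n.
    * by rewrite mulN1r opprB subr_gt0 kt.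
    * by rewrite mulN1r opprB -psiE ?kt // -bE.
    exists d, (cos theta); split=> //; left.
    by rewrite d1 sin2cos2; ring.
Qed.
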